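(* Let $\alpha,\beta,\gamma,\delta,\kappa$ be positive integers with $0<\gamma+\delta\le\beta+\kappa$ and $\kappa\le\min(\alpha,\gamma)$, and let $\bar k,\bar r$ be nonnegative integers. Then there is a $\mathbb{Z}_3\mathbb{Z}_9$-linear code $C$ of type $(\alpha,\beta;\gamma,\delta;\kappa)$ with $\ker(C)=\gamma+2\delta-\bar k$ and $\mathrm{rank}(C)=\gamma+2\delta+\bar r$ if and only if either $\bar k=\bar r=0$, or $\bar k\in\{1,\ldots,\delta\}$ and $$\bar r\in\left\{1,\ldots,\min\left(\beta-(\gamma-\kappa)-\delta,\ \binom{\bar k}{2}+\binom{\bar k+2}{3}\right)\right\}.$$
   Context: A $\mathbb{Z}_3\mathbb{Z}_9$-additive code $\mathcal{C}$ is a subgroup of $\mathbb{Z}_3^\alpha\times\mathbb{Z}_9^\beta$; as a group $\mathcal{C}\cong\mathbb{Z}_3^\gamma\times\mathbb{Z}_9^\delta$, and if $\kappa$ is the $\mathbb{Z}_3$-dimension of the projection onto the first $\alpha$ coordinates of the subcode of codewords of order dividing $3$, $\mathcal{C}$ has type $(\alpha,\beta;\gamma,\delta;\kappa)$. The Gray map $\phi:\mathbb{Z}_9\to\mathbb{Z}_3^3$ is $\phi(\theta)=\theta''(1,1,1)+\theta'(0,1,2)$ for $\theta=3\theta''+\theta'$, $\theta',\theta''\in\{0,1,2\}$, and $\Phi(\mathbf{x},\mathbf{y})=(\mathbf{x},\phi(y_1),\ldots,\phi(y_\beta))$. A $\mathbb{Z}_3\mathbb{Z}_9$-linear code of that type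 is $C=\Phi(\mathcal{C})$. $\mathrm{rank}(C)$ is the $\mathbb{Z}_3$-dimension of the linear span of $C$; $K(C)=\{\mathbf{x}\mid C+\mathbf{x}=C\}$ and $\ker(C)=\dim_{\mathbb{Z}_3}K(C)$. *)

(* Defs.v *)
From HB Require Import structures.
From mathcomp Require Import all_boot all_order all_algebra.
Set Implicit Arguments. Unset Strict Implicit. Unset Printing Implicit Defensive.
Import GRing.Theory.
Local Open Scope ring_scope.

Definition amb (a b : nat) := ('rV['F_3]_a * 'rV['Z_9]_b)%type.

Definition additive_code (a b : nat) (C : {set amb a b}) : Prop :=
  0 \in C /\ (forall x y, x \in C -> y \in C -> x - y \in C).

Definition group_iso_type (a b g d : nat) (C : {set amb a b}) : Prop :=
  exists f : ('rV['F_3]_g * 'rV['Z_9]_d)%type -> amb a b,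
    (forall u v, f (u + v) = f u + f v) /\ injective f /\
    [set f u | u in [set: ('rV['F_3]_g * 'rV['Z_9]_d)%type]] = C.

Definition span_dim (n : nat) (S : {set 'rV['F_3]_n}) : nat :=
  \dim <<enum S>>%VS.

Definition kappa_proj (a b : nat) (C : {set amb a b}) : {set 'rV['F_3]_a} :=
  [set c.1 | c in C & c *+ 3 == 0].

Definition code_of_type (a b g d k : nat) (C : {set amb a b}) : Prop :=
  [/\ additive_code C, group_iso_type g d C & span_dim (kappa_proj C) = k].

Definition gray (t : 'Z_9) : 'rV['F_3]_3 :=
  \row_(j < 3) (((t %/ 3)%N)%:R + ((t %% 3)%N)%:R * (j : nat)%:R).

Definition Phi (a b : nat) (c : amb a b) : 'rV['F_3]_(a + b * 3) :=
  row_mx c.1 (mxvec (\matrix_(i < b, j < 3) gray (c.2 0 i) 0 j)).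

Definition code_rank (n : nat) (C : {set 'rV['F_3]_n}) : nat := span_dim C.
Definition kernel_set (n : nat) (C : {set 'rV['F_3]_n}) : {set 'rV['F_3]_n} :=
  [set x | [set c + x | c in C] == C].
Definition code_ker (n : nat) (C : {set 'rV['F_3]_n}) : nat := span_dim (kernel_set C).

(* Main.v *)
From HB Require Import structures.
Require Import Defs.
From mathcomp Require Import all_boot all_order all_algebra all_field.
From mathcomp Require Import ring zify.
Set Implicit Arguments. Unset Strict Implicit. Unset Printing Implicit Defensive.
Import GRing.Theory.
Local Open Scope ring_scope.

(** Write y in Z_9 as lo y + 3 hi y.  Then hi (y + z) = hi y + hi z + P (lo y, lo z)
    for the carry polynomial P (x, y) = - (x^2 y + x y^2 + x y), and Phi is a linear
    injective image of (c.1, lo c.2, hi c.2).  With E = lo (C), H = {h | (0, 3 h) in C},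
    K = {e in E | P (e, E) <= H} and M = H + span P (E, E), counting gives
    dim ker = gamma + 2 delta - (dim E - dim K) and rank = gamma + 2 delta + (dim M - dim H).
    Polarising P, membership of all P (e, e') in a space means membership of all products
    e e' and e e' e'' of elements of E; hence M is spanned modulo H by the
    'C(kb, 2) + 'C(kb + 2, 3) reduced monomials of degree 2 and 3 in a basis of a
    complement of K in E, which yields the bounds.  Conversely, take generators (e_j | S_j)
    where the extra columns of S are points of F_3^kb: the monomials become their evaluations
    at these points.  They are independent functions on F_3^kb, so any number rb of
    independent evaluations can be realised, and one point with nonzero coordinates not
    summing to 1 already forces K to be as small as required. *)

(** * Counting in finite abelian groups, and arithmetic of F_3 *)

HB.instance Definition _ (U V : finZmodType) := GRing.Zmodule.on (U * V)%type.

Lemma card_additive (U V : finZmodType) (f : U -> V) (A : {set U}) :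
  (forall x y, x \in A -> y \in A -> x - y \in A) ->
  (forall x y, x \in A -> y \in A -> f (x - y) = f x - f y) ->
  #|A| = (#|f @: A| * #|[set x in A | f x == 0%R]|)%N.
Proof.
move=> AB fB.
have A0 x : x \in A -> 0 \in A by move=> Ax; rewrite -(subrr x) AB.
have f0 x : x \in A -> f 0 = 0 by move=> Ax; rewrite -(subrr x) fB // subrr.
have AN x : x \in A -> - x \in A by move=> Ax; rewrite -sub0r AB // (A0 x).
have fN x : x \in A -> f (- x) = - f x.
  by move=> Ax; rewrite -sub0r fB ?(f0 x) ?(A0 x) // sub0r.
rewrite -sum1_card (partition_big_imset f) /= -sum_nat_const.
apply: eq_bigr => _ /imsetP[x Ax ->].
(* Translation by - x carries the fibre over [f x] onto the kernel, so all fibres have the same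
   size. *)
rewrite sum1dep_card -(card_imset _ (addIr (- x))); apply: eq_card => z.
rewrite !inE; apply/imsetP/andP => [[y /[!inE]/andP[Ay /eqP fy] ->]|[Az /eqP fz]].
  by rewrite AB // fB // fy subrr.
exists (z + x); last by rewrite addrK.
have -> : z + x = z - (- x) by rewrite opprK.
by rewrite inE AB ?AN //= fB ?AN // fN // opprK fz add0r.
Qed.

Lemma F3_cases (x : 'F_3) : [\/ x = 0, x = 1 | x = -1].
Proof.
case: x => [[|[|[|//]]] i].
- by constructor 1; apply: val_inj.
- by constructor 2; apply: val_inj.
- by constructor 3; apply: val_inj.
Qed.

Lemma F3_char : 3%:R = 0 :> 'F_3.
Proof. exact: val_inj. Qed.

Lemma F3_cube (x : 'F_3) : x * x * x = x.
Proof. by case: (F3_cases x) => ->; apply: val_inj. Qed.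

Lemma F3_mulrn3 (V : lmodType 'F_3) (v : V) : v *+ 3 = 0.
Proof. by rewrite -scaler_nat F3_char scale0r. Qed.

(** * Base-3 digits of Z_9 *)

Definition lo9 (t : 'Z_9) : 'F_3 := (t %% 3)%:R.
Definition hi9 (t : 'Z_9) : 'F_3 := (t %/ 3)%:R.
Definition three9 (x : 'F_3) : 'Z_9 := (3 * x)%:R.
(** Interpolates the base-3 carry over F_3: its value is 1 at (1, 2), (2, 1), (2, 2) and 0
    elsewhere. *)
Definition carry (x y : 'F_3) : 'F_3 := - (x * x * y + x * y * y + x * y).

Ltac case9 x := case: x => [[|[|[|[|[|[|[|[|[|//]]]]]]]]] ?].

Lemma lo9_is_additive : zmod_morphism lo9.
Proof. by move=> x y; case9 x; case9 y; apply: val_inj. Qed.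

Lemma lo9_is_monoid_morphism : monoid_morphism lo9.
Proof.
by split=> [|x y]; [apply: val_inj | case9 x; case9 y; apply: val_inj].
Qed.

HB.instance Definition _ := GRing.isZmodMorphism.Build _ _ lo9 lo9_is_additive.
HB.instance Definition _ :=
  GRing.isMonoidMorphism.Build _ _ lo9 lo9_is_monoid_morphism.

Lemma hi9D x y : hi9 (x + y) = hi9 x + hi9 y + carry (lo9 x) (lo9 y).
Proof. by case9 x; case9 y; apply: val_inj. Qed.

Lemma lo9_three9 x : lo9 (three9 x) = 0.
Proof. by case: (F3_cases x) => ->; apply: val_inj. Qed.

Lemma hi9_three9 x : hi9 (three9 x) = x.
Proof. by case: (F3_cases x) => ->; apply: val_inj. Qed.

Lemma lo_hi9_inj x y : lo9 x = lo9 y -> hi9 x = hi9 y -> x = y.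
Proof.
case9 x; case9 y => // e1 e2; apply: val_inj;
  by move/(congr1 val): e1; move/(congr1 val): e2.
Qed.

Lemma three9_is_additive : zmod_morphism three9.
Proof.
by move=> x y; case: (F3_cases x) => ->; case: (F3_cases y) => ->; apply: val_inj.
Qed.

HB.instance Definition _ := GRing.isZmodMorphism.Build _ _ three9 three9_is_additive.

Lemma three9M x y : three9 x * y = three9 (x * lo9 y).
Proof. by case: (F3_cases x) => ->; case9 y; apply: val_inj. Qed.

Lemma mulrn3_Z9 x : x *+ 3 = three9 (lo9 x).
Proof. by case9 x; apply: val_inj. Qed.

(** * Subgroups of F_3^n as subspaces *)

Definition zmodset (V : finZmodType) (S : {set V}) : Prop :=
  0 \in S /\ (forall x y, x \in S -> y \in S -> x - y \in S).

Lemma zmodsetD (V : finZmodType) (S : {set V}) x y :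
  zmodset S -> x \in S -> y \in S -> x + y \in S.
Proof.
by move=> [S0 SB] Sx Sy; rewrite -[y]opprK SB // -sub0r SB.
Qed.

(** The only scalars are 0, 1 and -1, so a subgroup is closed under scaling and equals its span. *)
Lemma memv_span_zmodset n (S : {set 'rV['F_3]_n}) :
  zmodset S -> <<enum S>>%VS =i S.
Proof.
move=> SZ x; have [S0 SB] := SZ.
apply/idP/idP => [xS|xS]; last by apply: memv_span; rewrite mem_enum.
rewrite (coord_span (X := in_tuple (enum S)) xS).
elim/big_ind: _ => [//|u v Su Sv|i _]; first exact: zmodsetD.
have Si : (in_tuple (enum S))`_i \in S by rewrite -mem_enum mem_nth.
case: (F3_cases (coord (in_tuple (enum S)) i x)) => ->.
- by rewrite scale0r.
- by rewrite scale1r.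
- by rewrite scaleN1r -sub0r SB.
Qed.

Lemma card_zmodset n (S : {set 'rV['F_3]_n}) :
  zmodset S -> #|S| = (3 ^ span_dim S)%N.
Proof.
move=> SZ; rewrite -(eq_card (memv_span_zmodset SZ)).
by rewrite card_vspace card_Fp.
Qed.

Lemma card_F3_vspace n (U : {vspace 'rV['F_3]_n}) : #|U| = (3 ^ \dim U)%N.
Proof. by rewrite card_vspace card_Fp. Qed.

Lemma zmodset_image (U V : finZmodType) (f : U -> V) (A : {set U}) :
  (forall x y, f (x - y) = f x - f y) -> zmodset A -> zmodset (f @: A).
Proof.
move=> fB [A0 AB]; split.
  by apply/imsetP; exists 0 => //; rewrite -(subrr (0 : U)) fB subrr.
move=> _ _ /imsetP[x Ax ->] /imsetP[y Ay ->].
by rewrite -fB; apply: imset_f; apply: AB.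
Qed.

(** * Digit coordinates of codewords *)

Section Digits.

Variables a b : nat.

Definition lo (y : 'rV['Z_9]_b) : 'rV['F_3]_b := map_mx lo9 y.
Definition hi (y : 'rV['Z_9]_b) : 'rV['F_3]_b := map_mx hi9 y.
Definition three (h : 'rV['F_3]_b) : 'rV['Z_9]_b := map_mx three9 h.
Definition vcarry (u v : 'rV['F_3]_b) : 'rV['F_3]_b :=
  \row_j carry (u 0 j) (v 0 j).

Definition digits_space := ('rV['F_3]_a * 'rV['F_3]_b * 'rV['F_3]_b)%type.

Definition digits (c : amb a b) : digits_space := (c.1, lo c.2, hi c.2).

(** The Gray map as a function of the digits is additive; all nonlinearity of [Phi] sits in
    [digits]. *)
Definition gray_mx (w : digits_space) : 'rV['F_3]_(a + b * 3) :=
  row_mx w.1.1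
    (mxvec (\matrix_(i < b, j < 3) (w.2 0 i + w.1.2 0 i * (j : nat)%:R))).

Lemma Phi_digits c : Phi c = gray_mx (digits c).
Proof.
congr (row_mx _ (mxvec _)); apply/matrixP => i j.
by rewrite !mxE.
Qed.

Lemma gray_mxB w z : gray_mx (w - z) = gray_mx w - gray_mx z.
Proof.
rewrite /gray_mx opp_row_mx add_row_mx -[X in _ = row_mx _ X]linearB /=; congr (row_mx _ (mxvec _)).
by apply/matrixP => i j; rewrite !mxE /=; ring.
Qed.

Lemma gray_mxD w z : gray_mx (w + z) = gray_mx w + gray_mx z.
Proof.
have E0 : gray_mx 0 = 0 by rewrite -(subrr (0 : digits_space)) gray_mxB subrr.
have EN : gray_mx (- z) = - gray_mx z by rewrite -sub0r gray_mxB E0 sub0r.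
by rewrite -{1}[z]opprK gray_mxB EN opprK.
Qed.

Lemma gray_mx_inj : injective gray_mx.
Proof.
move=> [[x l] h] [[x' l'] h'] /eq_row_mx/= [-> /(can_inj mxvecK)/matrixP e].
(* Entry 0 of each Gray block is the high digit; entry 1 is the sum of both digits and yields the
   low one. *)
have eh : h = h'.
  by apply/rowP => i; have := e i ord0; rewrite !mxE /= !mulr0 !addr0.
rewrite eh; congr (_, _, _); apply/rowP => i; have := e i (lift ord0 ord0).
by rewrite !mxE /= eh !mulr1 => /addrI.
Qed.

Lemma loD y z : lo (y + z) = lo y + lo z. Proof. exact: map_mxD. Qed.
Lemma loB y z : lo (y - z) = lo y - lo z. Proof. exact: map_mxB. Qed.
Lemma lo0 : lo 0 = 0. Proof. exact: map_mx0. Qed.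
Lemma three0 : three 0 = 0. Proof. exact: map_mx0. Qed.
Lemma threeB g h : three (g - h) = three g - three h. Proof. exact: map_mxB. Qed.

Lemma hiD y z : hi (y + z) = hi y + hi z + vcarry (lo y) (lo z).
Proof. by apply/rowP => i; rewrite !mxE hi9D. Qed.

Lemma lo_three h : lo (three h) = 0.
Proof. by apply/rowP => i; rewrite !mxE lo9_three9. Qed.

Lemma hi_three h : hi (three h) = h.
Proof. by apply/rowP => i; rewrite !mxE hi9_three9. Qed.

Lemma lo_hi_inj y z : lo y = lo z -> hi y = hi z -> y = z.
Proof.
move=> /rowP el /rowP eh; apply/rowP => i.
by apply: lo_hi9_inj; have := el i; have := eh i; rewrite !mxE.
Qed.

Lemma three_hi y : lo y = 0 -> y = three (hi y).
Proof. by move=> y0; apply: lo_hi_inj; rewrite ?lo_three ?hi_three. Qed.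

Lemma mulrn3_rV y : y *+ 3 = three (lo y).
Proof. by apply/rowP => i; rewrite mulmxnE !mxE mulrn3_Z9. Qed.

Lemma three_eq0 h : (three h == 0) = (h == 0).
Proof.
apply/eqP/eqP => [e|->]; last exact: three0.
by rewrite -(hi_three h) e -three0 hi_three.
Qed.

Lemma mulrn3_ambE (c : amb a b) : c *+ 3 = (0, three (lo c.2)).
Proof.
rewrite -mulrn3_rV; case: c => x y /=.
by rewrite -[0](F3_mulrn3 x) !mulrS !mulr0n.
Qed.

Lemma mulrn3_amb (c : amb a b) : (c *+ 3 == 0) = (lo c.2 == 0).
Proof. by rewrite mulrn3_ambE xpair_eqE eqxx /= three_eq0. Qed.

Lemma vcarry0l u : vcarry 0 u = 0.
Proof. by apply/rowP => i; rewrite !mxE /carry; ring. Qed.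

Lemma vcarry0r u : vcarry u 0 = 0.
Proof. by apply/rowP => i; rewrite !mxE /carry; ring. Qed.

Lemma digitsD c c' :
  digits (c + c') = digits c + digits c' + (0, 0, vcarry (lo c.2) (lo c'.2)).
Proof. by rewrite /digits /= loD hiD; congr (_, _, _); rewrite /= addr0. Qed.

(** The low digits of [three h] vanish, so no carry arises and adding (0, 3 h) is a plain
    translation of the high digits. *)
Lemma digits_three c h : digits (c + (0, three h)) = digits c + (0, 0, h).
Proof.
rewrite /digits /= loD hiD lo_three hi_three vcarry0r.
by congr (_, _, _); rewrite addr0.
Qed.

Lemma digits0 : digits 0 = 0.
Proof.
by rewrite /digits /= lo0 -three0 hi_three.
Qed.

Lemma digits_inj : injective digits.
Proof. by move=> [x y] [x' y'] [-> el eh]; rewrite (lo_hi_inj el eh). Qed.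

(** Two fibrations in a row: first over the low digits, then over the ternary part, leaving the pure
    high-digit words. *)
Lemma card_digits_zmodset (S : {set digits_space}) : zmodset S ->
  #|S| = (#|[set w.1.2 | w in S]| * (#|[set w.1.1 | w in S & w.1.2 == 0%R]|
    * #|[set h | ((0, 0, h) : digits_space)%R \in S]|))%N.
Proof.
move=> [S0 SB]; pose S1 := [set w in S | w.1.2 == 0%R].
rewrite (card_additive (f := fun w => w.1.2)) //; congr (_ * _)%N.
rewrite (card_additive (f := fun w => w.1.1)) //; last first.
  move=> x y; rewrite !inE => /andP[Sx /eqP x0] /andP[Sy /eqP y0].
  by rewrite SB //= x0 y0 subrr eqxx.
congr (_ * _)%N.
have inj : injective (fun h => (0, 0, h) : digits_space) by move=> h h' [].
rewrite -(card_imset _ inj); apply: eq_card => -[[x l] h].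
rewrite !inE /=; apply/andP/imsetP => [[/andP[Sw /eqP l0] /eqP x0]|[h' Sh' [-> -> ->]]].
  by exists h; rewrite ?inE; rewrite x0 l0 in Sw *.
by rewrite inE in Sh'; rewrite Sh' eqxx.
Qed.

End Digits.

Lemma digitsB a b (c c' : amb a b) :
  digits c - digits c' =
  digits (c - c') + (0, 0, vcarry (lo (c - c').2) (lo c'.2)).
Proof.
have {1}-> : c = c - c' + c' by rewrite subrK.
by rewrite digitsD addrAC; congr (_ + _); rewrite addrK.
Qed.

(** * Rank and kernel as dimensions *)

Section Invariants.

Variables (a b : nat) (C : {set amb a b}) (E H K M : {vspace 'rV['F_3]_b}).
Hypothesis codeC : additive_code C.
Hypothesis memE : forall e, reflect (exists2 c, c \in C & lo c.2 = e) (e \in E).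
Hypothesis memH : forall h, (h \in H) = ((0, three h) \in C).
Hypothesis memK : forall e,
  reflect (e \in E /\ forall e', e' \in E -> vcarry e e' \in H) (e \in K).
Hypothesis subHM : (H <= M)%VS.
Hypothesis carryM : forall e e', e \in E -> e' \in E -> vcarry e e' \in M.
Hypothesis minM : forall U : {vspace 'rV['F_3]_b}, (H <= U)%VS ->
  (forall e e', e \in E -> e' \in E -> vcarry e e' \in U) -> (M <= U)%VS.

Let C0 : 0 \in C. Proof. by case: codeC. Qed.
Let CB x y : x \in C -> y \in C -> x - y \in C.
Proof. by case: codeC => _; apply. Qed.
Let CD x y : x \in C -> y \in C -> x + y \in C.
Proof. exact: (@zmodsetD (amb a b)). Qed.

Let C3 := [set c in C | c *+ 3 == 0].

Let in_C3 c : (c \in C3) = (c \in C) && (lo c.2 == 0).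
Proof. by rewrite inE mulrn3_amb. Qed.

Let C3_zmodset : zmodset C3.
Proof.
split=> [|x y]; first by rewrite in_C3 C0 lo0 eqxx.
rewrite !in_C3 => /andP[Cx /eqP x0] /andP[Cy /eqP y0].
by rewrite CB //= loB x0 y0 subrr eqxx.
Qed.

Lemma kappa_proj_zmodset : zmodset (kappa_proj C).
Proof. exact: (@zmodset_image (amb a b) _ (fun c => c.1)). Qed.

(** Fibre over the ternary part: the image is [kappa_proj C], and the kernel consists of the words
    (0, 3 h) with h in [H]. *)
Lemma card_order3 : #|C3| = (3 ^ (span_dim (kappa_proj C) + \dim H))%N.
Proof.
rewrite (@card_additive (amb a b) _ (fun c => c.1)) //; last first.
  by case: C3_zmodset => _; apply.
rewrite expnD -(card_zmodset kappa_proj_zmodset) -card_F3_vspace; congr (_ * _)%N.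
have inj : injective (fun h => (0, three h) : amb a b).
  by move=> h h' [/(congr1 (@hi b))]; rewrite !hi_three.
rewrite -(card_imset _ inj); apply: eq_card => -[x y].
rewrite inE in_C3; apply/andP/imsetP => [[/andP[/= Cy /eqP y0] /= /eqP x0]|[h Hh [-> ->]]].
  have e := three_hi y0.
  by exists (hi y); rewrite ?memH -e x0 // in Cy *.
by rewrite memH in Hh; rewrite Hh /= lo_three !eqxx.
Qed.

Lemma card_code : #|C| = (3 ^ (\dim E + (span_dim (kappa_proj C) + \dim H)))%N.
Proof.
rewrite expnD -card_order3 -card_F3_vspace.
rewrite (@card_additive (amb a b) _ (fun c => lo c.2)) //; last first.
  by move=> x y _ _; rewrite /= loB.
congr (_ * _)%N; apply: eq_card => e; last by rewrite in_C3 inE.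
by apply/imsetP/memE => -[c Cc e0]; exists c.
Qed.

(** The linear span of the Gray image in digit coordinates: thickening the high digits by [M]
    absorbs every carry. *)
Let R : {set digits_space a b} := [set digits c + (0, 0, m) | c in C, m in M].

Let mem_R c m : c \in C -> m \in M -> digits c + (0, 0, m) \in R.
Proof. by move=> Cc Mm; apply/imset2P; exists c m. Qed.

Let digits_R c : c \in C -> digits c \in R.
Proof.
move=> Cc; rewrite -[digits c]addr0; apply: (mem_R Cc); exact: mem0v.
Qed.

Let R_zmodset : zmodset R.
Proof.
split; first by rewrite -(digits0 a b) digits_R.
move=> _ _ /imset2P[c m Cc Mm ->] /imset2P[c' m' Cc' Mm' ->].
pose p := vcarry (lo (c - c').2) (lo c'.2).
apply/imset2P; exists (c - c') (p + m - m'); rewrite ?CB //.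
  rewrite memvB // memvD // carryM //; apply/memE; first by exists (c - c'); rewrite ?CB.
  by exists c'.
rewrite opprD addrACA digitsB -addrA -/p; congr (_ + _).
by congr (_, _, _); rewrite /= ?subrr ?addr0 ?addrA.
Qed.

Let card_R : #|R| = (3 ^ (\dim E + (span_dim (kappa_proj C) + \dim M)))%N.
Proof.
rewrite card_digits_zmodset // !expnD -(card_zmodset kappa_proj_zmodset) -!card_F3_vspace.
congr (_ * (_ * _))%N; apply: eq_card => x.
- apply/imsetP/memE => [[_ /imset2P[c m Cc Mm ->] ->]|[c Cc <-]].
    by exists c; rewrite //= addr0.
  by exists (digits c); rewrite ?digits_R.
- apply/imsetP/imsetP => [[w]|[c]].
    rewrite inE => /andP[/imset2P[c m Cc Mm ->]] /= /eqP; rewrite addr0 => l0 ->.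
    by exists c; rewrite ?in_C3 ?Cc ?l0 ?eqxx //= addr0.
  rewrite in_C3 => /andP[Cc /eqP l0] ->; exists (digits c) => //.
  by rewrite inE digits_R //= l0 eqxx.
- rewrite inE; apply/imset2P/idP => [[c m Cc Mm [/esym x0 /esym l0 ->]]|Mx].
    rewrite !addr0 in x0 l0; rewrite memvD // (subvP subHM) // memH.
    by rewrite -(three_hi l0) -x0; case: c Cc {x0 l0}.
  by exists (0 : amb a b) x; rewrite // digits0 add0r.
Qed.

Lemma code_rank_invariants :
  code_rank [set Phi c | c in C] = (\dim E + (span_dim (kappa_proj C) + \dim M))%N.
Proof.
apply/eqP; rewrite -(eqn_exp2l _ _ (isT : 1 < 3)%N) -card_R.
rewrite -(card_imset _ (@gray_mx_inj a b)).
have GZ : zmodset (@gray_mx a b @: R) by apply: zmodset_image => //; exact: gray_mxB.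
rewrite (card_zmodset GZ); apply/eqP; congr (3 ^ \dim _)%N.
set S := <<_>>%VS.
have SPhi c : c \in C -> gray_mx (digits c) \in S.
  by move=> Cc; apply: memv_span; rewrite mem_enum -Phi_digits imset_f.
apply/eqP; rewrite eqEsubv; apply/andP; split; apply/span_subvP => x; rewrite mem_enum.
  case/imsetP => c Cc ->; apply: memv_span; rewrite mem_enum Phi_digits.
  by apply: imset_f; apply: digits_R.
case/imsetP => _ /imset2P[c m Cc Mm ->] ->; rewrite gray_mxD.
apply: memvD; first exact: SPhi.
(* The high-digit words whose Gray image lies in the span form a subspace containing [H] and all
   carries, so minimality of [M] puts [M] inside it. *)
pose U := [set m | gray_mx (0, 0, m) \in S].
have UZ : zmodset U.
  split=> [|u v]; rewrite !inE.
    by have := SPhi _ C0; rewrite digits0.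
  move=> Su Sv; have -> : (0, 0, u - v) = (0, 0, u) - (0, 0, v) :> digits_space a b.
    by congr (_, _, _); rewrite subrr.
  by rewrite gray_mxB memvB.
suff : (M <= <<enum U>>)%VS by move/subvP/(_ _ Mm); rewrite memv_span_zmodset // inE.
apply: minM.
  apply/subvP => h; rewrite memv_span_zmodset // inE memH => /SPhi.
  by rewrite -[(0, three h)]add0r digits_three digits0 add0r.
move=> e e' /memE[c1 Cc1 <-] /memE[c2 Cc2 <-]; rewrite memv_span_zmodset // inE.
(* A carry is a linear combination of the digit vectors of three codewords. *)
have -> : (0, 0, vcarry (lo c1.2) (lo c2.2)) = digits (c1 + c2) - (digits c1 + digits c2).
  by rewrite digitsD addrC addrA addNr add0r.
by rewrite gray_mxB gray_mxD memvB ?memvD ?SPhi // CD.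
Qed.

Let KS : {set digits_space a b} := [set digits w | w in C & lo w.2 \in K].

(** Adding digit vectors equals adding codewords and then removing the carry; for [lo w.2] in [K]
    the carry lies in [H], so the corrected word stays in [C]. *)
Let mem_KS_add w w' : w \in C -> w' \in C -> lo w.2 \in K ->
  digits w + digits w' = digits (w + w' + (0, three (- vcarry (lo w.2) (lo w'.2))))
   /\ w + w' + (0, three (- vcarry (lo w.2) (lo w'.2))) \in C.
Proof.
move=> Cw Cw' /memK[_ Kw]; split.
  rewrite digits_three digitsD -addrA -[LHS]addr0; congr (_ + _).
  by congr (_, _, _); rewrite /= ?addr0 ?subrr.
rewrite CD ?CD // -memH memvN Kw //; apply/memE; by exists w'.
Qed.

Let KS_zmodset : zmodset KS.
Proof.
have KS0 : 0 \in KS.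
  by apply/imsetP; exists 0; rewrite ?digits0 // inE C0 lo0 mem0v.
have KSD x y : x \in KS -> y \in KS -> x + y \in KS.
  case/imsetP => w; rewrite inE => /andP[Cw Kw] ->.
  case/imsetP => w'; rewrite inE => /andP[Cw' Kw'] ->.
  have [-> ?] := mem_KS_add Cw Cw' Kw; apply: imset_f.
  by rewrite inE; apply/andP; split=> //=; rewrite !loD lo_three addr0 memvD.
split=> // x y KSx KSy; rewrite KSD //.
(* In characteristic 3, closure under addition gives closure under opposites. *)
have -> : - y = y + y; last exact: KSD.
apply/eqP; rewrite eq_sym -addr_eq0; apply/eqP.
have add3 n (v : 'rV['F_3]_n) : v + v + v = 0.
  by rewrite -[RHS](F3_mulrn3 v) !mulrS mulr0n addr0 addrA.
by case: y {KSy} => -[y1 y2] y3; congr (_, _, _); apply: add3.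
Qed.

Let card_KS : #|KS| = (3 ^ (\dim K + (span_dim (kappa_proj C) + \dim H)))%N.
Proof.
rewrite card_digits_zmodset // !expnD -(card_zmodset kappa_proj_zmodset) -!card_F3_vspace.
congr (_ * (_ * _))%N; apply: eq_card => x.
- apply/imsetP/idP => [[_ /imsetP[c /[!inE]/andP[_ Kc] -> ->]] //|Kx].
  have /memE[c Cc lc] : x \in E by case/memK: Kx.
  by exists (digits c); rewrite //= imset_f // inE Cc lc.
- apply/imsetP/imsetP => [[w]|[c]].
    rewrite inE => /andP[/imsetP[c /[!inE]/andP[Cc Kc] ->]] /= l0 ->.
    by exists c; rewrite ?in_C3 ?Cc.
  rewrite in_C3 => /andP[Cc /eqP l0] ->; exists (digits c) => //.
  by rewrite inE imset_f ?inE /= l0 ?mem0v ?Cc ?eqxx.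
- rewrite inE memH; apply/imsetP/idP => [[[y1 y2] /[!inE]/andP[Cc Kc] [-> /esym l0 ->]]|Cx].
    by rewrite -(three_hi l0).
  exists (0, three x); first by rewrite inE Cx /= lo_three mem0v.
  by rewrite -[(0, three x)]add0r digits_three digits0 add0r.
Qed.

(** The kernel of the Gray image is the image of [KS], so it is enough to count [KS]. *)
Lemma code_ker_invariants :
  code_ker [set Phi c | c in C] = (\dim K + (span_dim (kappa_proj C) + \dim H))%N.
Proof.
apply/eqP; rewrite -(eqn_exp2l _ _ (isT : 1 < 3)%N) -card_KS.
rewrite -(card_imset _ (@gray_mx_inj a b)).
have GZ : zmodset (@gray_mx a b @: KS) by apply: zmodset_image => //; exact: gray_mxB.
rewrite (card_zmodset GZ); apply/eqP; congr (3 ^ span_dim _)%N.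
apply/setP => x; rewrite inE; apply/eqP/imsetP => [Cx|[_ /imsetP[w /[!inE]/andP[Cw Kw] ->] ->]].
  have addx c : c \in C -> Phi c + x \in [set Phi c | c in C].
    by move=> Cc; rewrite -Cx; apply/imsetP; exists (Phi c); rewrite ?imset_f.
  (* Since [Phi 0] is 0, a translation preserving the image is itself by some [Phi w]. *)
  have /imsetP[w Cw xw] := addx _ C0.
  have {}xw : x = gray_mx (digits w).
    by rewrite -Phi_digits -xw Phi_digits digits0 -[in RHS](subrr 0) gray_mxB subrr add0r.
  exists (digits w) => //; apply: imset_f; rewrite inE Cw; apply/memK; split.
    by apply/memE; exists w.
  move=> _ /memE[c Cc <-].
  have /imsetP[c' Cc'] := addx _ Cc.
  rewrite xw !Phi_digits -gray_mxD => /gray_mx_inj e.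
  (* If the digits of w and c add up to those of c', then w + c and c' differ exactly by three times
     the carry. *)
  rewrite memH; suff -> : (0, three (vcarry (lo w.2) (lo c.2))) = w + c - c' by rewrite CB ?CD.
  apply/eqP; rewrite eq_sym subr_eq [_ + c']addrC; apply/eqP; apply: digits_inj.
  by rewrite digits_three -e digitsD [digits c + _]addrC.
(* Translations are injective, so one inclusion and equal cardinalities suffice. *)
apply/eqP; rewrite eqEcard; apply/andP; split; last first.
  by rewrite [leqRHS]card_imset // => u v /addIr.
apply/subsetP => _ /imsetP[_ /imsetP[c Cc ->] ->].
rewrite Phi_digits -gray_mxD addrC.
have [-> ?] := mem_KS_add Cw Cc Kw.
by rewrite -Phi_digits imset_f.
Qed.

End Invariants.

Lemma card_iso_type a b g d (C : {set amb a b}) :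
  group_iso_type g d C ->
  #|C| = (3 ^ (g + 2 * d))%N /\ #|[set c in C | c *+ 3 == 0]| = (3 ^ (g + d))%N.
Proof.
case=> f [fD [finj <-]]; rewrite card_imset // cardsT card_prod !card_mx card_Fp // card_ord.
rewrite !mul1n expnD expnM; split=> //.
have f0 : f 0 = 0 by apply: (addrI (f 0)); rewrite -fD !addr0.
(* Parametrises the elements of order dividing 3 in the model group Z_3^g x Z_9^d. *)
pose e (w : 'rV['F_3]_g * 'rV['F_3]_d) : 'rV['F_3]_g * 'rV['Z_9]_d := (w.1, three w.2).
have einj : injective (f \o e).
  apply: inj_comp => // -[x y] [x' y'] [-> /(congr1 (@hi d))].
  by rewrite !hi_three => ->.
transitivity #|[set (f \o e) w | w in [set: 'rV['F_3]_g * 'rV['F_3]_d]]|; last first.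
  by rewrite card_imset // cardsT card_prod !card_mx card_Fp // !mul1n expnD.
apply: eq_card => c; rewrite inE; apply/andP/imsetP.
  case=> /imsetP[[x y] _ ->]; have -> : f (x, y) *+ 3 = f ((x, y) *+ 3).
    by rewrite !mulrS !mulr0n !addr0 !fD.
  rewrite -f0 (inj_eq finj) mulrn3_amb /= => /eqP l0.
  by exists (x, hi y); rewrite ?inE //= /e /= -(three_hi l0).
case=> -[x y] _ ->; split; first exact: imset_f.
have -> : (f \o e) (x, y) *+ 3 = f (e (x, y) *+ 3).
    by rewrite !mulrS !mulr0n !addr0 !fD.
rewrite -f0 (inj_eq finj).
by have := mulrn3_amb (e (x, y)); rewrite lo_three eqxx.
Qed.

(** * Carries and products *)

Section Products.

Variable b : nat.
Implicit Types u v w : 'rV['F_3]_b.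

Definition pmul u v : 'rV['F_3]_b := \row_j (u 0 j * v 0 j).
Local Notation "u ** v" := (pmul u v) (at level 40, left associativity).

Lemma pmulC u v : u ** v = v ** u.
Proof. by apply/rowP => j; rewrite !mxE mulrC. Qed.

Lemma pmulA u v w : u ** (v ** w) = u ** v ** w.
Proof. by apply/rowP => j; rewrite !mxE mulrA. Qed.

Lemma pmulAC u v w : u ** v ** w = u ** w ** v.
Proof. by rewrite -!pmulA (pmulC v). Qed.

Lemma pmul_is_linear u : linear (pmul u).
Proof. by move=> k v w; apply/rowP => j; rewrite !mxE; ring. Qed.

HB.instance Definition _ u :=
  GRing.isLinear.Build _ _ _ _ (pmul u) (pmul_is_linear u).

Lemma pmulDl u v w : (u + v) ** w = u ** w + v ** w.
Proof. by apply/rowP => j; rewrite !mxE mulrDl. Qed.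

Lemma pmul_cube u : u ** u ** u = u.
Proof. by apply/rowP => j; rewrite !mxE F3_cube. Qed.

Lemma vcarryE u v : vcarry u v = - (u ** u ** v + u ** v ** v + u ** v).
Proof. by apply/rowP => j; rewrite !mxE. Qed.

(** Polarisation: the carries themselves are not bilinear, but they generate products that are
    linear in each factor. *)
Lemma carry_kernel_products (E H : {vspace 'rV['F_3]_b}) e : e \in E ->
  (forall e', e' \in E -> vcarry e e' \in H) ->
  forall e' e'', e' \in E -> e'' \in E -> e ** e' \in H /\ e ** e' ** e'' \in H.
Proof.
move=> Ee He.
have HB f : f \in E -> e ** f ** f \in H.
  (* The terms odd in f cancel, and the factor -2 left on the even one equals 1. *)
  move=> Ef; have -> : e ** f ** f = vcarry e f + vcarry e (- f).
    apply/rowP => j; rewrite !mxE /carry.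
    by case: (F3_cases (e 0 j)) => ->; case: (F3_cases (f 0 j)) => ->; apply: val_inj.
  by rewrite memvD // He // memvN.
have H3 f g : f \in E -> g \in E -> e ** f ** g \in H.
  move=> Ef Eg.
  (* Polarises the square: f^2 + g^2 - (f + g)^2 = -2 f g = f g. *)
  have -> : e ** f ** g
      = e ** f ** f + e ** g ** g - e ** (f + g) ** (f + g).
    apply/rowP => j; rewrite !mxE.
    by case: (F3_cases (e 0 j)) => ->; case: (F3_cases (f 0 j)) => ->;
       case: (F3_cases (g 0 j)) => ->; apply: val_inj.
  by rewrite memvB ?memvD ?HB // memvD.
move=> f g Ef Eg; split; last exact: H3.
have -> : e ** f = - vcarry e f - e ** f ** e - e ** f ** f.
  by rewrite vcarryE (pmulAC e f e); apply/rowP => j; rewrite !mxE; ring.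
by rewrite memvB ?H3 // memvB ?H3 // memvN He.
Qed.

Lemma linear_span (f : {linear 'rV['F_3]_b -> 'rV['F_3]_b}) (X : seq 'rV['F_3]_b)
    (U : {vspace 'rV['F_3]_b}) :
  (forall x, x \in X -> f x \in U) -> forall e, e \in <<X>>%VS -> f e \in U.
Proof.
move=> fX e eX; rewrite -(lfunE f) memv_preim; apply: (subvP _ _ eX).
by apply/span_subvP => x Xx; rewrite -memv_preim lfunE fX.
Qed.

End Products.

Notation "u ** v" := (pmul u v) (at level 40, left associativity).

(** * Reduced monomials of degree two and three *)

Definition set23 n (A : {set 'I_n}) := (#|A| == 2) || (#|A| == 3).

(** A pair (i, j) with distinct entries stands for x_i^2 x_j, a diagonal pair for the slot of x_i^3,
    and a set for a squarefree monomial. *)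
Definition mon_index n : finType :=
  ('I_n * 'I_n + {A : {set 'I_n} | set23 A})%type.

(* On F_3 the cube of x_i is x_i, so the slot of x_i^3 is taken by x_i^2 - x_i, which
   represents x_i^2 modulo the linear forms and vanishes at the unit vectors. *)
Definition mon_eval n (p : 'I_n -> 'F_3) (t : mon_index n) : 'F_3 :=
  match t with
  | inl ij => if ij.1 == ij.2 then p ij.1 * p ij.1 - p ij.1
              else p ij.1 * p ij.1 * p ij.2
  | inr A => \prod_(i in val A) p i
  end.

Definition mon n b (X : 'I_n -> 'rV['F_3]_b) (t : mon_index n) : 'rV['F_3]_b :=
  \row_l mon_eval (fun i => X i 0 l) t.

Lemma card_mon_index n : #|mon_index n| = ('C(n, 2) + 'C(n + 2, 3))%N.
Proof.
rewrite card_sum card_prod card_ord card_sig.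
have -> : #|[pred A : {set 'I_n} | set23 A]|
    = ('C(n, 2) + 'C(n, 3))%N.
  rewrite -[n in RHS]card_ord -!card_draws -cardsUI.
  have -> : [set A : {set 'I_n} | #|A| == 2] :&: [set A : {set 'I_n} | #|A| == 3] = set0.
    by apply/setP => A; rewrite !inE; case: eqP => // ->.
  by rewrite cards0 addn0; apply: eq_card => A; rewrite !inE.
(* From n (n - 1) = 2 C(n, 2) follows n^2 + C(n, 3) = C(n + 2, 3). *)
rewrite addn2 !binS bin1; have := mul_bin_diag n 1; rewrite bin1.
by case: n => [|n] //=; nia.
Qed.

Lemma mon_inlE n b (X : 'I_n -> 'rV['F_3]_b) i j :
  mon X (inl (i, j)) =
  if i == j then X i ** X i - X i else X i ** X i ** X j.
Proof. by case: eqP => [->|/eqP ne]; apply/rowP => l; rewrite !mxE /= ?eqxx // (negbTE ne). Qed.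

Lemma mon_set2 n b (X : 'I_n -> 'rV['F_3]_b) i j A :
  i != j -> val A = [set i; j] -> mon X (inr A) = X i ** X j.
Proof.
move=> ne eA; apply/rowP => l; rewrite !mxE /= eA big_setU1 ?inE //=.
by rewrite big_set1.
Qed.

Lemma mon_set3 n b (X : 'I_n -> 'rV['F_3]_b) i j k A :
  i != j -> i != k -> j != k -> val A = i |: [set j; k] ->
  mon X (inr A) = X i ** X j ** X k.
Proof.
move=> nij nik njk eA; apply/rowP => l; rewrite !mxE /= eA big_setU1 ?inE ?negb_or ?nij //=.
by rewrite big_setU1 ?inE //= big_set1 mulrA.
Qed.

Section Monomials.

Variables (n b : nat) (X : 'I_n -> 'rV['F_3]_b) (E H K : {vspace 'rV['F_3]_b}).
Hypothesis subEH : (E <= H)%VS.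
Hypothesis spanE : E = (<<codom X>> + K)%VS.
Hypothesis prodK : forall e e' e'', e \in K -> e' \in E -> e'' \in E ->
  e ** e' \in H /\ e ** e' ** e'' \in H.

Let M := (H + <<codom (mon X)>>)%VS.

Let subHM : (H <= M)%VS. Proof. exact: addvSl. Qed.

Let mon_M t : mon X t \in M.
Proof. by apply: (subvP (addvSr _ _)); apply: memv_span; apply: codom_f. Qed.

Let X_E i : X i \in E.
Proof. by rewrite spanE; apply: (subvP (addvSl _ _)); apply: memv_span; apply: codom_f. Qed.

Let X_H i : X i \in H. Proof. exact: (subvP subEH). Qed.

Let X_M i : X i \in M. Proof. exact: (subvP subHM). Qed.

Let mul2X i j : X i ** X j \in M.
Proof.
have [<-|ne] := eqVneq i j.
  (* The square is the diagonal monomial plus [X i], which already lies in [H]. *)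
  by rewrite -[_ ** _](subrK (X i)) memvD //; have := mon_M (inl (i, i)); rewrite mon_inlE eqxx.
have cA : set23 [set i; j] by rewrite /set23 cards2 ne.
by rewrite -(@mon_set2 _ _ X i j (exist (@set23 n) _ cA)).
Qed.

Let mul3X i j k : X i ** X j ** X k \in M.
Proof.
have M2 u v : X u ** X u ** X v \in M.
  have [<-|ne] := eqVneq u v; first by rewrite pmul_cube.
  by have := mon_M (inl (u, v)); rewrite mon_inlE (negbTE ne).
have [<-|nij] := eqVneq i j; first exact: M2.
have [<-|nik] := eqVneq i k; first by rewrite pmulAC.
have [<-|njk] := eqVneq j k; first by rewrite -pmulA pmulC M2.
have cA : set23 (i |: [set j; k]).
  by rewrite /set23 cardsU1 cards2 !inE negb_or nij nik njk.
by rewrite -(@mon_set3 _ _ X i j k (exist (@set23 n) _ cA)).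
Qed.

Let mul2S e f : e \in <<codom X>>%VS -> f \in <<codom X>>%VS -> e ** f \in M.
Proof.
move=> Se; apply: linear_span => _ /codomP[j ->]; rewrite /= pmulC.
by apply: linear_span Se => _ /codomP[i ->]; apply: mul2X.
Qed.

Let mul3S e f g : e \in <<codom X>>%VS -> f \in <<codom X>>%VS ->
  g \in <<codom X>>%VS -> e ** f ** g \in M.
Proof.
move=> Se Sf; apply: linear_span => _ /codomP[k ->]; rewrite /= pmulAC.
apply: linear_span Sf => _ /codomP[j ->]; rewrite /= pmulAC -pmulA pmulC.
by apply: linear_span Se => _ /codomP[i ->]; apply: mul3X.
Qed.

(** Each factor splits into a part spanned by [X] and a part in [K]. Products with a [K] factor fall
    in [H]; the others expand multilinearly into monomials. *)
Lemma carry_mon_span e f : e \in E -> f \in E -> vcarry e f \in M.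
Proof.
have split_E x : x \in E -> exists2 s, s \in <<codom X>>%VS &
    exists2 k, k \in K & x = s + k.
  by rewrite spanE => /memv_addP.
have SE s : s \in <<codom X>>%VS -> s \in E.
  by rewrite spanE; apply: (subvP (addvSl _ _)).
have KE s : s \in K -> s \in E.
  by rewrite spanE; apply: (subvP (addvSr _ _)).
have K2 x y : x \in K -> y \in E -> x ** y \in M.
  by move=> Kx Ey; apply: (subvP subHM); have [] := prodK Kx Ey Ey.
have K3 x y z : x \in K -> y \in E -> z \in E -> x ** y ** z \in M.
  by move=> Kx Ey Ez; apply: (subvP subHM); have [] := prodK Kx Ey Ez.
have E2 x y : x \in E -> y \in E -> x ** y \in M.
  move=> /split_E[s Ss [k Kk ->]] Ey; rewrite pmulDl.
  apply: memvD; last exact: K2.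
  have /split_E[s' Ss' [k' Kk' ->]] := Ey.
  rewrite linearD; apply: memvD; first exact: mul2S.
  by rewrite /= pmulC K2 // SE.
have E3 x y z : x \in E -> y \in E -> z \in E -> x ** y ** z \in M.
  move=> /split_E[s Ss [k Kk ->]] Ey Ez; rewrite pmulDl pmulDl.
  apply: memvD; last exact: K3.
  have /split_E[s' Ss' [k' Kk' ->]] := Ey.
  rewrite linearD pmulDl /=; apply: memvD; last by rewrite (pmulC s) K3 // SE.
  have /split_E[s'' Ss'' [k'' Kk'' ->]] := Ez.
  rewrite linearD /=; apply: memvD; first exact: mul3S.
  by rewrite pmulC pmulA K3 // SE.
move=> Ee Ef; rewrite vcarryE memvN; apply: memvD; last exact: E2.
by apply: memvD; apply: E3.
Qed.

(** Polarisation puts every double and triple product of the [X i] into [U], and each monomial is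
    such a product, up to some [X i] in [H]. *)
Lemma mon_span_min (U : {vspace 'rV['F_3]_b}) : (H <= U)%VS ->
  (forall e e', e \in E -> e' \in E -> vcarry e e' \in U) -> (M <= U)%VS.
Proof.
move=> HU cU; rewrite subv_add HU; apply/span_subvP => _ /codomP[t ->].
have U2 i j : X i ** X j \in U.
  by have [] := carry_kernel_products (X_E i) (fun e' => cU _ e' (X_E i)) (X_E j) (X_E j).
have U3 i j k : X i ** X j ** X k \in U.
  by have [] := carry_kernel_products (X_E i) (fun e' => cU _ e' (X_E i)) (X_E j) (X_E k).
case: t => [[i j]|A].
  rewrite mon_inlE; case: ifP => _; last exact: U3.
  by apply: memvB; [apply: U2 | apply: (subvP HU)].
have /orP[/cards2P[i [j [ne eA]]]|c3] : set23 (val A) := valP A.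
  by rewrite (mon_set2 _ ne eA).
have /card_gt0P[i Ai] : (0 < #|val A|)%N by rewrite (eqP c3).
have /cards2P[j [k [njk e]]] : #|val A :\ i| == 2.
  by move: c3; rewrite (cardsD1 i) Ai.
have : i \notin val A :\ i by rewrite !inE eqxx.
rewrite e !inE negb_or => /andP[nij nik].
by rewrite (mon_set3 _ nij nik njk) // -e setD1K.
Qed.

End Monomials.

(** * Evaluation of monomials at points *)

Section Evaluation.

Variable n : nat.
Local Notation point := {ffun 'I_n -> 'F_3}.
Local Notation N := #|mon_index n|.

Definition mon_row (p : point) : 'rV['F_3]_N := \row_k mon_eval p (enum_val k).

Lemma mon_eval_set_neq0 (p : point) (A : {A : {set 'I_n} | set23 A}) :
  mon_eval p (inr A) != 0 -> forall i, i \in val A -> p i != 0.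
Proof. by move/prodf_neq0. Qed.

(** Lets the zero point pad a list of columns without affecting any monomial. *)
Lemma mon_eval0 t : mon_eval ([ffun=> 0] : point) t = 0.
Proof.
apply/eqP; case: t => [[i j]|A] /=; first by case: ifP; rewrite !ffunE ?mulr0 ?subr0.
apply: contraT => /mon_eval_set_neq0 pA.
have /card_gt0P[i /pA] : (0 < #|val A|)%N by case/orP: (valP A) => /eqP ->.
by rewrite ffunE eqxx.
Qed.

Let W := <<codom mon_row>>%VS.

Let ind t : 'rV['F_3]_N := delta_mx 0 (enum_rank t).

Let mon_row_W p : mon_row p \in W.
Proof. by apply: memv_span; apply: codom_f. Qed.

Let mon_rowE p t : mon_row p 0 (enum_rank t) = mon_eval p t.
Proof. by rewrite mxE enum_rankK. Qed.

(** Elimination step: subtracting from [v] the coordinate vectors already in [W] leaves a nonzero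
    multiple of [ind t]. *)
Let ind_W v t : v \in W -> v 0 (enum_rank t) != 0 ->
  (forall t', t' != t -> v 0 (enum_rank t') != 0 -> ind t' \in W) -> ind t \in W.
Proof.
move=> Wv vt others; move: Wv; rewrite {1}[v]row_sum_delta (bigD1 (enum_rank t)) //= => Wv.
suff : v 0 (enum_rank t) *: ind t \in W by rewrite rpredZeq (negbTE vt).
rewrite -[X in X \in W](addrK (\sum_(i | i != enum_rank t) v 0 i *: delta_mx 0 i)).
apply: memvB => //; apply: memv_suml => k; rewrite -(enum_valK k) (inj_eq enum_rank_inj) => ne.
by rewrite rpredZeq; case: eqP => //= /eqP v0; apply: others.
Qed.

(** The sign matters: x_i^2 - x_i vanishes at 1 but not at -1. *)
Let unit_pt i : point := [ffun l => - (l == i)%:R].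
Let plus_pt i j : point := [ffun l => (l == i)%:R + (l == j)%:R].
Let minus_pt i j : point := [ffun l => (l == i)%:R - (l == j)%:R].
Let set_pt (A : {set 'I_n}) : point := [ffun l => (l \in A)%:R].

Lemma set23_other (A : {A : {set 'I_n} | set23 A}) i : exists2 l, l \in val A & l != i.
Proof.
have : (0 < #|val A :\ i|)%N.
  have := cardsD1 i (val A); have : set23 (val A) := valP A.
  by case: (i \in val A) => /orP[]/eqP ->; lia.
by case/card_gt0P => l; rewrite !inE => /andP[ne Al]; exists l.
Qed.

Let ind_diag i : ind (inl (i, i)) \in W.
Proof.
apply: (ind_W (mon_row_W (unit_pt i))).
  by rewrite mon_rowE /= !eqxx !ffunE eqxx.
move=> t ne; rewrite mon_rowE; case: t ne => [[j k]|A] ne /=.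
  case: (j =P k) ne => [<-{k}|/eqP njk] ne.
    rewrite !ffunE; case: (j =P i) ne => [->|_ _]; first by rewrite eqxx.
    by rewrite oppr0 mulr0 subr0 eqxx.
  rewrite !ffunE; case: (j =P i) => [ji|_]; last by rewrite oppr0 !mul0r eqxx.
  by rewrite -ji [k == j]eq_sym (negbTE njk) oppr0 mulr0 eqxx.
move=> /mon_eval_set_neq0 pA; have [l Al nl] := set23_other A i.
by have := pA l Al; rewrite ffunE (negbTE nl) oppr0 eqxx.
Qed.

(** In the sum of the evaluations at e_i + e_j and e_i - e_j, terms odd in x_j cancel; apart from
    x_j^2 x_i only the diagonal monomial of j survives. *)
Let ind_pair i j : i != j -> ind (inl (j, i)) \in W.
Proof.
move=> nij; have nji : j != i by rewrite eq_sym.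
apply: (ind_W (memvD (mon_row_W (plus_pt i j)) (mon_row_W (minus_pt i j)))).
  rewrite mxE !mon_rowE /= !(negbTE nij, negbTE nji) !ffunE !eqxx.
  by rewrite !(negbTE nij, negbTE nji).
move=> t ne; rewrite mxE !mon_rowE; case: t ne => [[k l]|A] ne /=.
  case: (k =P l) ne => [<- {l} _|/eqP nkl ne].
    rewrite !ffunE; case: (k =P j) => [-> _|_]; first exact: ind_diag.
    by case: (k =P i); rewrite ?addr0 ?subr0 ?mulr0 ?mulr1 ?subrr ?eqxx.
  rewrite !ffunE; case: (k =P i) ne nkl => [->|nki] ne nkl.
    case: (l =P j) => [->|nlj]; first by rewrite (negbTE nij) (negbTE nji).
    by rewrite [l == i]eq_sym (negbTE nkl) addr0 subr0 !mulr0 addr0 eqxx.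
  case: (k =P j) ne nkl => [->|nkj] ne nkl; last by rewrite addr0 subr0 !mul0r addr0 eqxx.
  case: (l =P i) ne => [->|nli ne]; first by rewrite eqxx.
  by rewrite [l == j]eq_sym (negbTE nkl) addr0 subr0 !mulr0 addr0 eqxx.
have [eA|neA] := eqVneq (val A) [set i; j].
  rewrite eA !(big_setU1, big_set1) ?inE //= !ffunE !eqxx !(negbTE nij, negbTE nji).
  by rewrite addr0 add0r mulr1 subr0 sub0r mul1r addrN eqxx.
have [l Al nl] : exists2 l, l \in val A & l \notin [set i; j].
  apply/subsetPn; apply: contra neA => sA; rewrite eqEcard sA cards2 nij.
  by case/orP: (valP A) => /eqP ->.
rewrite (bigD1 l) //= [X in _ + X](bigD1 l) //= !ffunE.
move: nl; rewrite !inE negb_or => /andP[/negbTE-> /negbTE->].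
by rewrite addr0 subr0 !mul0r addr0 eqxx.
Qed.

(** Induction on the size of A: at the indicator of A the surviving monomials are mixed pairs,
    already treated, and products over subsets of A. *)
Let ind_set A : ind (inr A) \in W.
Proof.
have [m lem] := ubnP #|val A|; elim: m A lem => // m IH A lem.
apply: (ind_W (mon_row_W (set_pt (val A)))).
  rewrite mon_rowE /=; apply/prodf_neq0 => i iA; by rewrite ffunE iA oner_eq0.
move=> t ne; rewrite mon_rowE; case: t ne => [[k l]|B] ne.
  rewrite /=; case: (k =P l) => [_|/eqP nkl _]; last by apply: ind_pair; rewrite eq_sym.
  by rewrite ffunE; case: (_ \in _); rewrite ?mulr1 ?mulr0 subrr eqxx.
move/mon_eval_set_neq0 => pB; apply: IH.
apply: leq_trans (lem : (#|val A| <= m)%N); apply: proper_card.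
rewrite properEneq; apply/andP; split.
  by apply: contra ne => /eqP/val_inj ->.
by apply/subsetP => i /pB; rewrite ffunE; case: (_ \in _); rewrite ?eqxx.
Qed.

(** Dually, the reduced monomials are linearly independent functions on F_3^n. *)
Lemma mon_row_full : <<codom mon_row>>%VS = fullv.
Proof.
apply/eqP; rewrite eqEsubv subvf; apply/subvP => v _.
rewrite [v]row_sum_delta; apply: memv_suml => k _; apply: memvZ.
rewrite -(enum_valK k); case: (enum_val k) => [[i j]|A]; last exact: ind_set.
have [<-|ne] := eqVneq i j; first exact: ind_diag.
by apply: ind_pair; rewrite eq_sym.
Qed.

(** Greedy extension from [p0]: the evaluations span the whole space, so while fewer than N are
    chosen some point gives a new independent one. *)
Lemma free_points p0 r : mon_row p0 != 0 -> (0 < r <= N)%N ->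
  exists s : seq point, [/\ size s = r, p0 \in s & free (map mon_row s)].
Proof.
move=> p0n0; elim: r => [//|[|r] IH] /= ltr.
  by exists [:: p0]; rewrite mem_seq1 eqxx /= free_cons span_nil memv0 p0n0 nil_free.
have [s [szs sp0 frs]] := IH (ltnW ltr).
have /subvPn[v /=] : ~~ (fullv <= <<map mon_row s>>)%VS.
  apply/negP => /dimvS; rewrite dimvf /dim /= mul1n (eqP frs) size_map szs.
  by rewrite leqNgt ltr.
rewrite -mon_row_full => Wv nv.
have [p np] : exists p, mon_row p \notin <<map mon_row s>>%VS.
  apply/existsP; apply: contraR nv; rewrite negb_exists => /forallP all.
  apply: (subvP _ _ Wv); apply/span_subvP => _ /codomP[p ->].
  by have := all p; rewrite negbK.
by exists (p :: s); rewrite /= szs in_cons sp0 orbT free_cons np.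
Qed.

End Evaluation.

(** * Matrices with prescribed monomial rank and trivial kernel condition *)

Lemma rank_le_dimv N m (B : 'M['F_3]_(N, m)) (U : {vspace 'rV['F_3]_m}) :
  (forall k, row k B \in U) -> (\rank B <= \dim U)%N.
Proof.
move=> rowU; pose B' := rowsub (maxrankfun B) B.
pose X := [tuple row i B' | i < \rank B].
have frX : free X.
  apply/freeP => k sum0 i.
  have /row_freeP[D BD] : row_free B' := maxrowsub_free B.
  have : (\row_i k i) *m B' = 0.
    rewrite mulmx_sum_row -[RHS]sum0; apply: eq_bigr => j _.
    by rewrite mxE -tnth_nth tnth_mktuple.
  move/(congr1 (mulmx^~ D)); rewrite -mulmxA BD mulmx1 mul0mx => /rowP/(_ i).
  by rewrite !mxE.
have <- : \dim <<X>> = \rank B by rewrite (eqP frX) size_tuple.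
apply: dimvS; apply/span_subvP => _ /mapP[i _ ->].
by rewrite /B' row_rowsub.
Qed.

(** Row rank equals column rank: the monomials are the rows of a matrix whose first r columns are
    the independent evaluations and whose other columns vanish. *)
Lemma dim_mon_points n m r (s : seq {ffun 'I_n -> 'F_3}) (le_rm : (r <= m)%N)
    (S := \matrix_(i < n, t < m) nth [ffun=> 0] s t i) :
  size s = r -> free (map (@mon_row n) s) ->
  \dim <<codom (mon (fun i => row i S))>> = r.
Proof.
move=> szs frs.
have monE t l : mon (fun i => row i S) t 0 l = mon_eval (nth [ffun=> 0] s l) t.
  rewrite mxE; case: t => [[i j]|A] /=; rewrite ?mxE //.
  by apply: eq_bigr => i _; rewrite !mxE.
apply/eqP; rewrite eqn_leq; apply/andP; split.
  pose dl (l : 'I_r) : 'rV['F_3]_m := delta_mx 0 (widen_ord le_rm l).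
  have <- : size (codom dl) = r by rewrite size_codom card_ord.
  apply: leq_trans (dim_span (codom dl)); apply: dimvS; apply/span_subvP => _ /codomP[t ->].
  rewrite [mon _ _]row_sum_delta; apply: memv_suml => l _.
  have [lt_lr|le_rl] := ltnP l r.
    apply/memvZ/memv_span/codomP; exists (Ordinal lt_lr).
    by congr (delta_mx _ _); apply: val_inj.
  by rewrite monE nth_default ?szs // mon_eval0 scale0r mem0v.
pose A := \matrix_(t < r) mon_row (nth [ffun=> 0] s t).
pose B := \matrix_(k < #|mon_index n|) mon (fun i => row i S) (enum_val k).
have frA : row_free A.
  apply: inj_row_free => v vA; apply/rowP => i; rewrite [RHS]mxE.
  have tE : size (map (@mon_row n) s) == r by rewrite size_map szs.
  have /freeP fr : free (Tuple tE) by [].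
  apply: (fr (v 0)); rewrite -[RHS]vA mulmx_sum_row; apply: eq_bigr => j _.
  by rewrite rowK (nth_map [ffun=> 0]) ?szs.
rewrite -(eqP frA); apply: (@leq_trans (\rank B)); last first.
  by apply: rank_le_dimv => k; rewrite rowK; apply: memv_span; apply: codom_f.
rewrite -[X in (_ <= X)%N]mxrank_tr; apply: mxrankS.
have -> : A = rowsub (widen_ord le_rm) B^T.
  by apply/matrixP => t k; rewrite [RHS]mxE [RHS]mxE [RHS]mxE monE !mxE.
exact: rowsub_sub.
Qed.

(** A column with nonzero entries forces all coordinates of v to equal one constant c, with c = c s
    for s the sum of that column; s different from 1 gives c = 0. *)
Lemma good_matrix n m r : (r <= m)%N ->
  ((n == 0) && (r == 0) || (0 < n) && (0 < r <= #|mon_index n|))%N ->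
  exists2 S : 'M['F_3]_(n, m), \dim <<codom (mon (fun i => row i S))>> = r &
    forall v : 'rV_n,
      (forall j, (v *m S) ** row j S = v 0 j *: row j S) -> v = 0.
Proof.
move=> le_rm /orP[/andP[/eqP n0 /eqP r0]|/andP[n_gt0 r_bd]].
  rewrite n0 r0; exists 0; last by move=> v _; apply/rowP => -[].
  apply/eqP; rewrite -leqn0; apply: leq_trans (dim_span _) _.
  by rewrite size_map -cardE card_mon_index.
pose i0 := Ordinal n_gt0.
have [p0 [p0_neq0 p0_row p0_sum]] : exists p0 : {ffun 'I_n -> 'F_3},
    [/\ forall i, p0 i != 0, mon_row p0 != 0 & \sum_i p0 i != 1].
  have row_neq0 (p : {ffun 'I_n -> 'F_3}) t : mon_eval p t != 0 -> mon_row p != 0.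
    by apply: contra => /eqP/rowP/(_ (enum_rank t)); rewrite !mxE enum_rankK => ->.
  (* The all-ones point has sum n; when n is 1 modulo 3, one sign change turns the sum into n - 2 =
     -1. *)
  have [n1|n1] := eqVneq (n%:R : 'F_3) 1; last first.
    exists [ffun=> 1]; split=> [i||]; first by rewrite ffunE.
      have n_gt1 : (1 < n)%N by case: n n1 n_gt0 {i0 r_bd row_neq0} => [|[]].
      (* Diagonal monomials vanish at the all-ones point, so a mixed one x_0^2 x_1 is the
         witness. *)
      apply: (row_neq0 _ (inl (i0, Ordinal n_gt1))).
      by rewrite /= !ffunE.
    by under eq_bigr do rewrite ffunE; rewrite sumr_const card_ord.
  exists [ffun i => if i == i0 then -1 else 1]; split=> [i||].
  - by rewrite ffunE; case: ifP.
  - by apply: (row_neq0 _ (inl (i0, i0))); rewrite /= !ffunE !eqxx.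
  have -> : \sum_i [ffun i => if i == i0 then -1 else 1] i = n%:R - 2%:R :> 'F_3.
    transitivity (\sum_(i < n) (1 - (i == i0)%:R *+ 2 : 'F_3)).
      by apply: eq_bigr => i _; rewrite ffunE; case: ifP => _; apply: val_inj.
    rewrite sumrB sumr_const card_ord sumrMnl (bigD1 i0) //= ?eqxx big1 ?addr0 //.
    by move=> i /negbTE ->.
  by rewrite n1.
have [s [szs sp0 frs]] := free_points p0_row r_bd.
pose S : 'M['F_3]_(n, m) := \matrix_(i, t) nth [ffun=> 0] s t i.
exists S => [|v vS]; first exact: dim_mon_points.
have lt_t : (index p0 s < m)%N by rewrite (leq_trans _ le_rm) // -szs index_mem.
pose t := Ordinal lt_t.
have S_t i : S i t = p0 i by rewrite mxE /= nth_index.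
have vE j : v 0 j = (v *m S) 0 t.
  have := congr1 (fun w : 'rV_m => w 0 t) (vS j); rewrite /= !mxE nth_index //.
  by move/(mulIf (p0_neq0 j)).
have : (v *m S) 0 t * (\sum_i p0 i - 1) = 0.
  rewrite mulrBr mulr1 {2}mxE mulr_sumr -sumrB big1 // => i _.
  by rewrite S_t (vE i) subrr.
move/eqP; rewrite mulf_eq0 subr_eq0 (negbTE p0_sum) orbF => /eqP v0.
by apply/rowP => j; rewrite vE v0 mxE.
Qed.

(** * The spaces attached to a code, and necessity of the bounds *)

Lemma code_spaces a b (C : {set amb a b}) : additive_code C ->
  exists E H K : {vspace 'rV['F_3]_b},
  [/\ forall e, e \in E <-> exists2 c, c \in C & lo c.2 = e,
      forall h, (h \in H) = ((0, three h) \in C),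
      forall e, e \in K <->
        e \in E /\ (forall e', e' \in E -> vcarry e e' \in H) &
      (E <= H)%VS].
Proof.
move=> codeC; have [C0 CB] := codeC.
have CZ : @zmodset (amb a b) C := codeC.
have ZE : zmodset [set lo c.2 | c in C].
  by apply: (@zmodset_image (amb a b) _ (fun c => lo c.2)) => // x y; rewrite /= loB.
pose Hs : {set 'rV['F_3]_b} := [set h | (0, three h) \in C].
have ZH : zmodset Hs.
  split=> [|h h']; rewrite !inE; first by rewrite three0; exact: C0.
  move=> Ch Ch'.
  suff -> : (0, three (h - h')) = (0, three h) - (0, three h') :> amb a b.
    exact: CB.
  by rewrite threeB; congr (_, _); rewrite subrr.
pose E := <<enum [set lo c.2 | c in C]>>%VS.
pose H := <<enum Hs>>%VS.
have memE e : reflect (exists2 c, c \in C & lo c.2 = e) (e \in E).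
  by rewrite memv_span_zmodset //; apply: (iffP imsetP) => -[c Cc e0]; exists c.
have memH h : (h \in H) = ((0, three h) \in C) by rewrite memv_span_zmodset // inE.
pose K := [set e in E | [forall (e' | e' \in E), vcarry e e' \in H]].
have memK e : reflect (e \in E /\ forall e', e' \in E -> vcarry e e' \in H) (e \in K).
  by rewrite inE; apply: (iffP andP) => -[Ee /forall_inP He].
have ZK : zmodset K.
  split=> [|e f /memK[Ee /(carry_kernel_products Ee) He] /memK[Ef /(carry_kernel_products Ef) Hf]].
    apply/memK; split=> [|e _]; first exact: mem0v.
    by rewrite vcarry0l; exact: mem0v.
  have Eef : e - f \in E by apply: memvB.
  apply/memK; split=> // x Ex.
  (* A carry is not additive in its first argument; closure of [K] under subtraction goes through
     products, which are. *)
  have He3 y z : y \in E -> z \in E -> (e - f) ** y ** z \in H.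
    move=> Ey Ez; have -> : (e - f) ** y ** z = e ** y ** z - f ** y ** z.
      by apply/rowP => j; rewrite !mxE; ring.
    by apply: memvB; [case: (He y z) | case: (Hf y z)].
  have He2 : (e - f) ** x \in H.
    have -> : (e - f) ** x = e ** x - f ** x.
      by apply/rowP => j; rewrite !mxE; ring.
    by apply: memvB; [case: (He x x) | case: (Hf x x)].
  rewrite vcarryE memvN; apply: memvD => //.
  by apply: memvD; apply: He3.
exists E, H, <<enum K>>%VS; split=> //.
- by move=> e; split=> [/memE|? ]; last apply/memE.
- by move=> e; rewrite memv_span_zmodset //; split=> [/memK|?]; last apply/memK.
apply/subvP => _ /memE[c Cc <-]; rewrite memH.
(* The word (0, 3 lo c) is c + c + c, a codeword. *)
rewrite -mulrn3_ambE !mulrS mulr0n addr0.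
by do 2?[apply: (zmodsetD CZ) => //].
Qed.

Lemma rank_ker_necessary a b g d k kb rb (C : {set amb a b}) :
  (g + d <= b + k)%N -> (k <= g)%N -> code_of_type g d k C ->
  (code_ker [set Phi c | c in C] + kb = g + 2 * d)%N ->
  code_rank [set Phi c | c in C] = (g + 2 * d + rb)%N ->
  (kb = 0 /\ rb = 0)%N \/
  ((1 <= kb <= d)%N /\
   (1 <= rb <= minn (b - (g - k) - d) ('C(kb, 2) + 'C(kb + 2, 3)))%N).
Proof.
move=> le_gd le_kg [codeC /card_iso_type[cardC cardC3] kappaC].
have [E [H [K [iffE memH iffK subEH]]]] := code_spaces codeC.
have memE e := equivP idP (iffE e); have memK e := equivP idP (iffK e).
(* A basis of a complement of [K] in [E]; its size will be [kb]. *)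
pose D := (E :\: K)%VS; pose X (i : 'I_(\dim D)) := (vbasis D)`_i.
have KE : (K <= E)%VS by apply/subvP => e /memK[].
have spanX : <<codom X>>%VS = D.
  have /andP[/eqP eD _] := vbasisP D; apply: etrans eD; apply: eq_span => x.
  apply/codomP/idP => [[i ->]|/(nthP 0)[i lti <-]]; first by rewrite mem_nth // size_tuple.
  by rewrite size_tuple in lti; exists (Ordinal lti).
have spanE : E = (<<codom X>> + K)%VS.
  by rewrite spanX -[X in (_ + X)%VS](capv_idPr KE) addv_diff_cap.
have dimD : (\dim K + \dim D = \dim E)%N.
  by rewrite -(dimv_cap_compl E K) (capv_idPr KE).
have prodK e e' e'' : e \in K -> e' \in E -> e'' \in E ->
    e ** e' \in H /\ e ** e' ** e'' \in H.
  by case/memK => Ee He; apply: carry_kernel_products Ee He _ _.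
pose M := (H + <<codom (mon X)>>)%VS.
have carryM e f : e \in E -> f \in E -> vcarry e f \in M.
  exact: (carry_mon_span subEH spanE prodK).
have subHM : (H <= M)%VS by apply: addvSl.
have minM U : (H <= U)%VS ->
    (forall e e', e \in E -> e' \in E -> vcarry e e' \in U) -> (M <= U)%VS.
  exact: (mon_span_min subEH spanE).
rewrite (code_ker_invariants codeC memE memH memK).
rewrite (code_rank_invariants codeC memE memH subHM carryM minM).
move: cardC; rewrite (card_code codeC memE memH) => /(expnI (isT : 1 < 3)%N).
move: cardC3; rewrite (card_order3 codeC memH) => /(expnI (isT : 1 < 3)%N).
rewrite kappaC => dimH dimE dimK dimM.
(* As [H] has dimension g + d - k, this yields the bound b - (g - k) - d on [rb]. *)
have dimMb : (\dim M <= b)%N.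
  by have := dimvS (subvf M); rewrite dimvf /dim /= mul1n.
have dimD_kb : \dim D = kb by lia.
have dimM_le : (\dim M <= \dim H + #|mon_index (\dim D)|)%N.
  rewrite -(size_codom (mon X)); apply: leq_trans (leq_add (leqnn _) (dim_span _)).
  by rewrite -dimv_sum_cap leq_addr.
rewrite dimD_kb card_mon_index in dimM_le.
(* Both defects vanish together: K = E means that all carries lie in [H], which is M = H. *)
have kb0_rb0 : (kb = 0 -> rb = 0)%N.
  move=> kb0; have /eqP KeqE : K == E by rewrite eqEdim KE; lia.
  have /dimvS : (M <= H)%VS.
    by apply: minM => // e e'; rewrite -{1}KeqE => /memK[_ He] /He.
  lia.
have rb0_kb0 : (rb = 0 -> kb = 0)%N.
  move=> rb0; have /eqP HeqM : H == M by rewrite eqEdim subHM; lia.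
  have /dimvS : (E <= K)%VS.
    by apply/subvP => e Ee; apply/memK; split=> // e' Ee'; rewrite HeqM carryM.
  lia.
have [kb0|kb_neq0] := eqVneq kb 0%N; [left | right]; first by rewrite kb0_rb0.
split; first by lia.
rewrite leq_min; apply/andP; split; last by apply/andP; split; lia.
by case: rb rb0_kb0 {kb0_rb0 dimM} kb_neq0 => // ->.
Qed.

(** * Codes with prescribed rank and kernel *)

Definition lift9 (x : 'F_3) : 'Z_9 := (x : nat)%:R.

Lemma lift9K x : lo9 (lift9 x) = x.
Proof. by case: (F3_cases x) => ->; apply: val_inj. Qed.

Lemma eq_mon_eval n (p q : 'I_n -> 'F_3) t : p =1 q -> mon_eval p t = mon_eval q t.
Proof.
by move=> pq; case: t => [[i j]|A] /=; [rewrite !pq | apply: eq_bigr => i _].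
Qed.

(** Hence the identity block of the generators contributes nothing to the monomials. *)
Lemma mon_eval_delta n (l : 'I_n) t : mon_eval (fun i => (i == l)%:R) t = 0.
Proof.
case: t => [[i j]|A] /=.
  case: (i =P j) => [_|/eqP ne]; first by case: (i == l); rewrite ?mulr1 ?mulr0 subrr.
  case: (i =P l) => [il|_]; last by rewrite !mul0r.
  by rewrite -il [j == i]eq_sym (negbTE ne) mulr0.
have [i iA /negbTE ni] := set23_other A l.
by rewrite (bigD1 i) //= ni mul0r.
Qed.

Lemma eq_mon n b (X Y : 'I_n -> 'rV['F_3]_b) t : X =1 Y -> mon X t = mon Y t.
Proof.
by move=> XY; apply/rowP => l; rewrite !mxE; apply: eq_mon_eval => i; rewrite XY.
Qed.

Lemma mon_delta n t : mon (fun i : 'I_n => delta_mx 0 i) t = 0.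
Proof.
apply/rowP => l; rewrite !mxE -[RHS](mon_eval_delta l t).
by apply: eq_mon_eval => i; rewrite !mxE eqxx eq_sym.
Qed.

Lemma mon_zero n b t : mon (fun i : 'I_n => 0 : 'rV_b) t = 0.
Proof.
apply/rowP => l; rewrite !mxE -[RHS](mon_eval0 t).
by apply: eq_mon_eval => i; rewrite ffunE.
Qed.

Lemma mon_row_mx n b1 b2 (X : 'I_n -> 'rV_b1) (Y : 'I_n -> 'rV_b2) t :
  mon (fun i => row_mx (X i) (Y i)) t = row_mx (mon X t) (mon Y t).
Proof.
apply/rowP => l; rewrite -(splitK l); case: (split l) => j /=.
  rewrite row_mxEl !mxE; apply: eq_mon_eval => i; exact: row_mxEl.
rewrite row_mxEr !mxE; apply: eq_mon_eval => i; exact: row_mxEr.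
Qed.

Lemma pmul_row_mx b1 b2 (u u' : 'rV_b1) (v v' : 'rV_b2) :
  row_mx u v ** row_mx u' v' = row_mx (u ** u') (v ** v').
Proof.
apply/rowP => l; rewrite -(splitK l); case: (split l) => j /=;
  by rewrite !(mxE, row_mxEl, row_mxEr).
Qed.

Lemma vcarry_row_mx b1 b2 (u u' : 'rV_b1) (v v' : 'rV_b2) :
  vcarry (row_mx u v) (row_mx u' v') = row_mx (vcarry u u') (vcarry v v').
Proof.
apply/rowP => l; rewrite -(splitK l); case: (split l) => j /=;
  by rewrite !(mxE, row_mxEl, row_mxEr).
Qed.

Section Construction.

Variables (k a g n d m : nat) (S : 'M['F_3]_(n, m)).
Let A := (k + a)%N.
Let B := (g + ((n + d) + m))%N.

Let S9 : 'M['Z_9]_(n, m) := map_mx lift9 S.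

Let enc (v : 'rV['F_3]_(n + d)) : 'rV['F_3]_B := row_mx 0 (row_mx v (lsubmx v *m S)).

(** Generator matrix in standard form: here [g] plays the role of gamma - kappa, [n] of the kernel
    defect, [d] of delta - n, and [m] counts the columns filled by [S]. *)
Let gen (w : 'rV['F_3]_(k + g) * 'rV['Z_9]_(n + d)) : amb A B :=
  (row_mx (lsubmx w.1) 0,
   row_mx (three (rsubmx w.1)) (row_mx w.2 (lsubmx w.2 *m S9))).

Definition std_code : {set amb (k + a) (g + ((n + d) + m))} :=
  [set gen w | w in [set: 'rV['F_3]_(k + g) * 'rV['Z_9]_(n + d)]].

Let gen_code w : gen w \in std_code. Proof. exact: imset_f. Qed.

Let genD u v : gen (u + v) = gen u + gen v.
Proof.
congr (_, _) => /=; first by rewrite linearD add_row_mx addr0.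
rewrite !add_row_mx -mulmxDl -!linearD /=; congr (row_mx _ _).
by rewrite linearD; apply: map_mxD.
Qed.

Let gen0 : gen 0 = 0. Proof. by apply: (addrI (gen 0)); rewrite -genD !addr0. Qed.

Let gen_inj : injective gen.
Proof.
move=> [u v] [u' v'] [/eq_row_mx[eu _] /eq_row_mx[/= eu2 /eq_row_mx[-> _]]].
congr (_, _); rewrite -(hsubmxK u) -(hsubmxK u') eu; congr (row_mx _ _).
by rewrite -[LHS]hi_three eu2 hi_three.
Qed.

Let genB u v : gen (u - v) = gen u - gen v.
Proof. by apply: (addIr (gen v)); rewrite -genD !subrK. Qed.

Lemma std_code_additive : additive_code std_code.
Proof.
split; first by rewrite -gen0.
by move=> _ _ /imsetP[u _ ->] /imsetP[v _ ->]; rewrite -genB.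
Qed.

Lemma std_code_iso : group_iso_type (k + g) (n + d) std_code.
Proof. by exists gen. Qed.

Let lo_S9 : map_mx lo9 S9 = S.
Proof. by apply/matrixP => i j; rewrite !mxE lift9K. Qed.

Let lo_gen w : lo (gen w).2 = enc (lo w.2).
Proof.
rewrite /lo /enc /= !map_row_mx map_mxM lo_S9 map_lsubmx.
by congr (row_mx _ _); apply: lo_three.
Qed.

Let lo_lift (v : 'rV['F_3]_(n + d)) : lo (map_mx lift9 v) = v.
Proof. by apply/rowP => i; rewrite !mxE lift9K. Qed.

Let enc_inj : injective enc.
Proof. by move=> v v' /eq_row_mx[_ /eq_row_mx[]]. Qed.

Let three_mulS (v : 'rV['F_3]_n) : three v *m S9 = three (v *m S).
Proof.
apply/rowP => j; rewrite !mxE raddf_sum; apply: eq_bigr => i _.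
by rewrite !mxE three9M lift9K.
Qed.

Let gen_three u v : gen (u, three v) =
  (row_mx (lsubmx u) 0, three (row_mx (rsubmx u) (row_mx v (lsubmx v *m S)))).
Proof.
congr (_, _) => /=; rewrite /three !map_row_mx -!/(three _).
by congr (row_mx _ (row_mx _ _)); rewrite -three_mulS /three map_lsubmx.
Qed.

Lemma std_code_kappa : span_dim (kappa_proj std_code) = k.
Proof.
apply/eqP; rewrite -(eqn_exp2l _ _ (isT : 1 < 3)%N).
rewrite -(card_zmodset (kappa_proj_zmodset std_code_additive)); apply/eqP.
have inj : injective (fun u : 'rV['F_3]_k => row_mx u (0 : 'rV_a)).
  by move=> u v /eq_row_mx[].
rewrite -[k in RHS]mul1n -[3%N in RHS](@card_Fp 3) // -card_mx -(card_imset _ inj).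
apply: eq_card => x; apply/imsetP/imsetP => -[].
  by move=> _ /[!inE]/andP[/imsetP[w _ ->] _] ->; exists (lsubmx w.1).
move=> u _ ->; exists (gen (row_mx u 0, 0)); last by rewrite /= row_mxKl.
by rewrite inE gen_code mulrn3_amb lo_gen lo0 /enc linear0 mul0mx !row_mx0 eqxx.
Qed.

Section Kernel.

Hypothesis kerS : forall v : 'rV_n,
  (forall j, (v *m S) ** row j S = v 0 j *: row j S) -> v = 0.

Variables E H K : {vspace 'rV['F_3]_B}.
Hypothesis memE : forall e,
  reflect (exists2 c, c \in std_code & lo c.2 = e) (e \in E).
Hypothesis memH : forall h, (h \in H) = ((0, three h) \in std_code).
Hypothesis memK : forall e,
  reflect (e \in E /\ forall e', e' \in E -> vcarry e e' \in H) (e \in K).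

Let E_enc e : reflect (exists v, e = enc v) (e \in E).
Proof.
apply: (iffP (memE e)) => [[_ /imsetP[w _ ->] <-]|[v ->]].
  by exists (lo w.2); apply: lo_gen.
exists (gen (0, map_mx lift9 v)); first exact: gen_code.
by rewrite lo_gen lo_lift.
Qed.

Let H_enc h : reflect (exists u v, h = row_mx u (row_mx v (lsubmx v *m S))) (h \in H).
Proof.
rewrite memH; apply: (iffP idP) => [/imsetP[[u w] _ e]|[u [v ->]]].
  have lw : lo w = 0.
    apply: enc_inj; rewrite -(lo_gen (u, w)) -e /= lo_three.
    by rewrite /enc linear0 mul0mx !row_mx0.
  rewrite (three_hi lw) gen_three in e; case: e => _ /(congr1 (@hi B)).
  by rewrite !hi_three => ->; exists (rsubmx u), (hi w).
apply/imsetP; exists (row_mx 0 u, three v) => //.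
by rewrite gen_three row_mxKl row_mxKr row_mx0.
Qed.

Let X (i : 'I_n) := enc (delta_mx 0 (lshift d i)).

Let XE i : X i = row_mx 0 (row_mx (row_mx (delta_mx 0 i) 0) (row i S)).
Proof.
have -> : X i = enc (row_mx (delta_mx 0 i) 0); last by rewrite /enc row_mxKl -rowE.
congr enc; apply/rowP => j; rewrite -(splitK j); case: (split j) => l /=.
  by rewrite row_mxEl !mxE eq_lshift.
by rewrite row_mxEr !mxE eq_rlshift.
Qed.

(** In [H] the last m coordinates are determined by the middle ones. For a product with [X j] this
    is the equation of [kerS], so the first n coordinates of v vanish. *)
Let K_enc e : reflect (exists v, e = enc (row_mx 0 v)) (e \in K).
Proof.
apply: (iffP (memK e)) => [[/[dup] Ee /E_enc[v ev] He]|[v ->]].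
  suff v0 : lsubmx v = 0 by exists (rsubmx v); rewrite -v0 hsubmxK.
  apply: kerS => j.
  have EX : X j \in E by apply/E_enc; exists (delta_mx 0 (lshift d j)).
  have [/H_enc[u [w eH]] _] := carry_kernel_products Ee He EX EX.
  move: eH; rewrite XE ev /enc -{1}(hsubmxK v) !pmul_row_mx.
  move=> /eq_row_mx[_ /eq_row_mx[<- ->]]; rewrite row_mxKl.
  rewrite rowE scalemxAl; congr (_ *m _); apply/rowP => i; rewrite !mxE eqxx /=.
  by case: (i =P j) => [->|_]; rewrite ?mulr0.
split; first by apply/E_enc; exists (row_mx 0 v).
move=> _ /E_enc[v' ->]; apply/H_enc; exists 0.
exists (row_mx 0 (vcarry v (rsubmx v'))).
rewrite /enc !row_mxKl !mul0mx -{1}(hsubmxK v') !vcarry_row_mx.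
by rewrite !vcarry0l.
Qed.

Lemma dim_kernel : \dim K = d.
Proof.
apply/eqP; rewrite -(eqn_exp2l _ _ (isT : 1 < 3)%N) -card_F3_vspace.
have inj : injective (fun v : 'rV['F_3]_d => enc (row_mx 0 v)).
  by move=> u v /enc_inj/eq_row_mx[].
rewrite -[d in eqbRHS]mul1n -[3%N in eqbRHS](@card_Fp 3) // -card_mx -(card_imset _ inj).
apply/eqP/eq_card => x; apply/K_enc/imsetP => [[v ->]|[v _ ->]]; by exists v.
Qed.

Let spanX_E : E = (<<codom X>> + K)%VS.
Proof.
pose G : 'M['F_3]_(n, B) := row_mx 0 (row_mx (row_mx 1%:M 0) S).
have XG i : X i = row i G.
  by rewrite XE [RHS]rowE !mul_mx_row !mulmx0 mulmx1 -rowE.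
apply/eqP; rewrite eqEsubv subv_add; apply/and3P; split.
- apply/subvP => _ /E_enc[v ->]; apply/memv_addP.
  exists (lsubmx v *m G).
    rewrite mulmx_sum_row; apply: memv_suml => i _; apply/memvZ/memv_span.
    by rewrite -XG codom_f.
  exists (enc (row_mx 0 (rsubmx v))); first by apply/K_enc; exists (rsubmx v).
  rewrite /enc row_mxKl mul0mx !mul_mx_row !mulmx0 mulmx1 !add_row_mx !addr0 add0r.
  by rewrite hsubmxK.
- apply/span_subvP => _ /codomP[i ->]; apply/E_enc.
  by exists (delta_mx 0 (lshift d i)).
- by apply/subvP => e /memK[].
Qed.

Let mon_X t : mon X t = row_mx 0 (row_mx 0 (mon (fun i => row i S) t)).
Proof.
by rewrite (eq_mon _ XE) !mon_row_mx mon_delta !mon_zero row_mx0.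
Qed.

(** The monomials live in the last m coordinates only, while a word of [H] with zero middle block is
    zero there; the sum is direct. *)
Let dim_mon_X :
  \dim (H + <<codom (mon X)>>) = (\dim H + \dim <<codom (mon (fun i => row i S))>>)%N.
Proof.
pose L : 'Hom('rV['F_3]_m, 'rV['F_3]_B) :=
  linfun (mulmxr (row_mx 0 (row_mx 0 1%:M))).
have LE s : L s = row_mx 0 (row_mx 0 s).
  by rewrite lfunE /= !mul_mx_row !mulmx0 mulmx1.
have -> : <<codom (mon X)>>%VS = (L @: <<codom (mon (fun i => row i S))>>)%VS.
  rewrite limg_span; congr <<_>>%VS; rewrite -map_comp; apply: eq_map => t.
  by rewrite /= LE mon_X.
rewrite dimv_disjoint_sum.
  congr (_ + _)%N; apply: limg_dim_eq; apply/eqP; rewrite -subv0; apply/subvP => s.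
  rewrite memv_cap memv_ker memv0 LE => /andP[_ /eqP].
  move/(congr1 (fun x : 'rV_(g + (n + d + m)) => rsubmx (rsubmx x))).
  by rewrite !row_mxKr !linear0 => ->.
apply/eqP; rewrite -subv0; apply/subvP => h; rewrite memv_cap memv0.
move=> /andP[/H_enc[u [v ->]] /memv_imgP[s _]]; rewrite LE => /eq_row_mx[-> /eq_row_mx[-> _]].
by rewrite linear0 mul0mx !row_mx0.
Qed.

Lemma std_code_invariants :
  (code_ker [set Phi c | c in std_code] + n = (k + g) + 2 * (n + d))%N /\
  code_rank [set Phi c | c in std_code] =
    ((k + g) + 2 * (n + d) + \dim <<codom (mon (fun i => row i S))>>)%N.
Proof.
have subEH : (E <= H)%VS.
  by apply/subvP => _ /E_enc[v ->]; apply/H_enc; exists 0, v.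
have prodK e e' e'' : e \in K -> e' \in E -> e'' \in E ->
    e ** e' \in H /\ e ** e' ** e'' \in H.
  by case/memK => Ee He; apply: carry_kernel_products Ee He _ _.
have carryM := carry_mon_span subEH spanX_E prodK.
have minM := mon_span_min subEH spanX_E.
have subHM := addvSl H <<codom (mon X)>>.
rewrite (code_ker_invariants std_code_additive memE memH memK).
rewrite (code_rank_invariants std_code_additive memE memH subHM carryM minM).
have [cardC cardC3] := card_iso_type std_code_iso.
move: cardC; rewrite (card_code std_code_additive memE memH) => /(expnI (isT : 1 < 3)%N).
move: cardC3; rewrite (card_order3 std_code_additive memH) => /(expnI (isT : 1 < 3)%N).
rewrite std_code_kappa dim_mon_X dim_kernel => dimH dimE.
by rewrite (addnA k) [in X in _ /\ X]addnA dimE dimH; split=> //; lia.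
Qed.

End Kernel.

Lemma std_code_rank_ker :
  (forall v : 'rV_n,
     (forall j, (v *m S) ** row j S = v 0 j *: row j S) -> v = 0) ->
  (code_ker [set Phi c | c in std_code] + n = (k + g) + 2 * (n + d))%N /\
  code_rank [set Phi c | c in std_code] =
    ((k + g) + 2 * (n + d) + \dim <<codom (mon (fun i => row i S))>>)%N.
Proof.
move=> kerS; have [E [H [K [iffE memH iffK _]]]] := code_spaces std_code_additive.
exact: (std_code_invariants kerS (fun e => equivP idP (iffE e)) memH
  (fun e => equivP idP (iffK e))).
Qed.

End Construction.

Theorem theorem17 (a b g d k kb rb : nat) :
  (0 < a)%N -> (0 < b)%N -> (0 < g)%N -> (0 < d)%N -> (0 < k)%N ->
  (0 < g + d <= b + k)%N -> (k <= minn a g)%N ->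
  (exists C : {set amb a b},
      [/\ @code_of_type a b g d k C,
          (code_ker [set Phi c | c in C] + kb = g + 2 * d)%N &
          code_rank [set Phi c | c in C] = (g + 2 * d + rb)%N])
  <->
  ((kb = 0 /\ rb = 0)%N \/
   ((1 <= kb <= d)%N /\
    (1 <= rb <= minn (b - (g - k) - d) ('C(kb, 2) + 'C(kb + 2, 3)))%N)).
Proof.
move=> _ _ _ _ _ /andP[_ le_gd]; rewrite leq_min => /andP[le_ka le_kg].
split=> [[C [typeC kerC rankC]]|bounds].
  exact: rank_ker_necessary typeC kerC rankC.
have [a' ea] : exists a', a = (k + a')%N by exists (a - k)%N; lia.
have [g' eg] : exists g', g = (k + g')%N by exists (g - k)%N; lia.
have [d' ed] : exists d', d = (kb + d')%N.
  by exists (d - kb)%N; case: bounds => [[-> _]|[]]; lia.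
(* [m] is the number b - (g - k) - d of free columns, the first bound on [rb]. *)
have [m em] : exists m, b = (g' + ((kb + d') + m))%N.
  by exists (b - (g' + (kb + d')))%N; lia.
subst a g d b.
have le_rm : (rb <= m)%N by case: bounds => [[_ ->]|[]] //; lia.
have [|S dimS kerS] := good_matrix le_rm (n := kb).
  rewrite card_mon_index; case: bounds => [[-> ->] //|[kb_bd rb_bd]].
  by apply/orP; right; lia.
exists (std_code k a' g' d' S).
have [ker_eq rank_eq] := std_code_rank_ker k a' g' d' kerS.
split=> //; last by rewrite rank_eq dimS.
split; [exact: std_code_additive | exact: std_code_iso | exact: std_code_kappa].
Qed.
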